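(* Consider the model $\mathbf{y}=\alpha\boldsymbol{\iota}+\beta\mathbf{W}\mathbf{y}+\mathbf{W}\mathbf{X}\boldsymbol{\delta}+\mathbf{X}\boldsymbol{\gamma}+\mathbf{v}$ with $n$ nodes and $k$ covariates, and set $\mathbf{S}=[\mathbf{y},\mathbf{X}]$ and $\boldsymbol{\theta}=(\beta,\boldsymbol{\delta}^{\top})^{\top}$. Suppose: (1) There is an $n\times n$ adjacency matrix $\mathbf{W}_0$ such that $E_{\mathbf{X},\mathbf{W}_0}[\mathbf{v}]=\mathbf{0}$. (2) $\mathbf{W}\mathbf{S}=\mathbf{W}_0\mathbf{S}\mathbf{\Pi}+\mathbf{U}$, where $\mathbf{\Pi}$ is a $(k+1)\times(k+1)$ coefficient matrix and the $n\times(k+1)$ error matrix $\mathbf{U}$ satisfies $E_{\mathbf{W}_0\mathbf{y},\mathbf{W}_0,\mathbf{X}}[\mathbf{U}]=\mathbf{O}$; the matrix $E[\mathbf{S}^{\top}\mathbf{w}_{0;i}\mathbf{w}_{0;i}^{\top}\mathbf{S}]$ is positive definite; $\operatorname{rank}(\mathbf{\Pi})=k+1$; and $\boldsymbol{\pi}_1^{\top}\boldsymbol{\theta}<1/\lambda_{\max}$, where $\boldsymbol{\pi}_j^{\top}$ denotes the $j$th row of $\mathbf{\Pi}$ and $\lambda_{\max}$ is the largest eigenvalue of $\mathbf{W}_0$. (3) For every $j\in\{1,\dots,k\}$, $$\beta(\gamma_j\pi_{1,1}+\pi_{j+1,1})+\sum_{l=1}^{k}\delta_l(\gamma_j\pi_{1,l+1}+\pi_{j+1,l+1})\neq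 0 .$$ (4) The matrices $\mathbf{I}$, $\mathbf{W}_0$ and $\mathbf{W}_0^2$ are linearly independent. Then the parameters $\alpha$, $\beta$, $\boldsymbol{\gamma}$ and $\boldsymbol{\delta}$ are identified.
   Context: Notation. $\mathbf{y}$ is the $n\times1$ outcome vector, $\mathbf{X}=[\mathbf{x}_1,\dots,\mathbf{x}_k]$ is the $n\times k$ covariate matrix, $\boldsymbol{\iota}$ is the $n\times 1$ vector of ones, $\mathbf{v}$ is the $n\times1$ error vector, $\alpha,\beta$ are scalars and $\boldsymbol{\gamma},\boldsymbol{\delta}\in\mathbb{R}^k$. $\mathbf{W}$ is an $n\times n$ random adjacency matrix (possibly correlated with $\mathbf{v}$). $\mathbf{W}$ and $\mathbf{W}_0$ may or may not be row-normalized, directed or weighted. $\mathbf{w}_{0;i}$ is the $i$th row of $\mathbf{W}_0$ written as a column vector. $E_{A}[\cdot]$ denotes conditional expectation given $A$. $\pi_{i,j}$ is the $(i,j)$ entry of $\mathbf{\Pi}$. $\mathbf{I}$ is the $n\times n$ identity and $\mathbf{O}$ a matrix of zeros. Reduced form. Substituting the relation in (2) into the model gives, with $\mathbf{e}=\mathbf{U}\boldsymbol{\theta}+\mathbf{v}$ and with $\mathbf{I}-(\boldsymbol{\pi}_1^{\top}\boldsymbol{\theta})\mathbf{W}_0$ invertible, $$\mathbf{y}=[\mathbf{I}-(\boldsymbol{\pi}_1^{\top}\boldsymbol{\theta})\mathbf{W}_0]^{-1}\Big\{\alpha\boldsymbol{\iota}+\sum_{j=1}^k[\gamma_j\mathbf{I}+(\boldsymbol{\pi}_{j+1}^{\top}\boldsymbol{\theta})\mathbf{W}_0]\mathbf{x}_j+\mathbf{e}\Big\}.$$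 Identification. The matrix $\mathbf{\Pi}$ is uniquely determined by the distribution of the observables. ''Identified'' means: if two parameter vectors $(\alpha,\beta,\boldsymbol{\gamma},\boldsymbol{\delta})$ and $(\alpha',\beta',\boldsymbol{\gamma}',\boldsymbol{\delta}')$ satisfying the assumptions (with the same $\mathbf{\Pi}$ and $\mathbf{W}_0$) lead to the same reduced form, i.e. to the same intercept vector $[\mathbf{I}-(\boldsymbol{\pi}_1^{\top}\boldsymbol{\theta})\mathbf{W}_0]^{-1}\alpha\boldsymbol{\iota}$ and to the same coefficient matrices $[\mathbf{I}-(\boldsymbol{\pi}_1^{\top}\boldsymbol{\theta})\mathbf{W}_0]^{-1}[\gamma_j\mathbf{I}+(\boldsymbol{\pi}_{j+1}^{\top}\boldsymbol{\theta})\mathbf{W}_0]$ on $\mathbf{x}_j$ for all $j=1,\dots,k$, then they are equal. *)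

(* Defs.v *)
From HB Require Import structures.
From mathcomp Require Import all_boot all_order all_algebra.
From mathcomp Require Import all_classical all_reals all_analysis.
Set Implicit Arguments.
Unset Strict Implicit.
Unset Printing Implicit Defensive.
Import Order.TTheory GRing.Theory Num.Theory.
Import numFieldNormedType.Exports.
Local Open Scope classical_set_scope.
Local Open Scope ring_scope.

Section LinearAlgebra.
Context {R : realType}.

Definition is_max_eigenvalue n (A : 'M[R]_n) (lam : R) : Prop :=
  eigenvalue A lam /\ forall mu : R, eigenvalue A mu -> mu <= lam.

Definition posdef m (M : 'M[R]_m) : Prop :=
  M^T = M /\ forall x : 'cV[R]_m, x != 0 -> 0 < (x^T *m M *m x) 0 0.

End LinearAlgebra.

Section RandomMatrices.
Context {d : measure_display} {T : measurableType d} {R : realType}.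
Variable P : probability T R.

Definition measurable_mx m n (A : T -> 'M[R]_(m, n)) : Prop :=
  forall i j, measurable_fun setT (fun w => A w i j).

(* The events {A i j \in B}: a random matrix generates the sigma-algebra
   <<s events A>>, and a pair of them generates <<s events A `|` events B>>. *)
Definition events m n (A : T -> 'M[R]_(m, n)) : set (set T) :=
  [set E | exists i j,
     preimage_set_system setT (fun w => A w i j) measurable E].

(* g is a version of the conditional expectation of f given the
   sigma-algebra G. *)
Definition is_cond_expectation (G : set (set T)) (f g : T -> R) : Prop :=
  [/\ P.-integrable setT (EFin \o f),
      P.-integrable setT (EFin \o g),
      forall B : set R, measurable B -> G (g @^-1` B)
    & forall E, G E ->
        (\int[P]_(w in E) (g w)%:E = \int[P]_(w in E) (f w)%:E)%E].

Definition cond_mean_zero (G : set (set T)) m n (A : T -> 'M[R]_(m, n)) : Prop :=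
  forall i j, is_cond_expectation G (fun w => A w i j) (fun=> 0).

Definition integrable_mx m n (A : T -> 'M[R]_(m, n)) : Prop :=
  forall i j, P.-integrable setT (EFin \o (fun w => A w i j)).

(* [fine] loses nothing when A is integrable. *)
Definition expectation_mx m n (A : T -> 'M[R]_(m, n)) : 'M[R]_(m, n) :=
  \matrix_(i, j) fine ('E_P[fun w => A w i j])%E.

(* Linear independence in the space of random matrices modulo almost sure
   equality; for a constant A this is linear independence of I, A, A^2 in
   'M[R]_n, and it holds whenever the realizations of I, A, A^2 are linearly
   independent almost surely. *)
Definition lin_indep_I_A_A2 n (A : T -> 'M[R]_n) : Prop :=
  forall c0 c1 c2 : R,
    {ae P, forall w, c0 *: 1%:M + c1 *: A w + c2 *: (A w *m A w) = 0} ->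
    [/\ c0 = 0, c1 = 0 & c2 = 0].

End RandomMatrices.

Record params (R : realType) (k : nat) := Params {
  alpha : R;
  beta  : R;
  gamma : 'cV[R]_k;
  delta : 'cV[R]_k }.

Section Model.
Context {R : realType} {n k : nat}.

Definition iota_vec : 'cV[R]_n := const_mx 1.

Definition theta (p : params R k) : 'cV[R]_(1 + k) :=
  col_mx (beta p)%:M (delta p).

(* In the coordinates 1 + k of S = [y, X], the first one is [yix] and the one of
   the j-th covariate is [xix j]. *)
Definition yix : 'I_(1 + k) := lshift k ord0.
Definition xix (j : 'I_k) : 'I_(1 + k) := rshift 1 j.

(* The scalar product of a row of Pi with theta. *)
Definition pi_theta (Pi : 'M[R]_(1 + k)) (p : params R k) (r : 'I_(1 + k)) : R :=
  (row r Pi *m theta p) 0 0.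

Definition rf_mx (W0 : 'M[R]_n) (Pi : 'M[R]_(1 + k)) (p : params R k) : 'M[R]_n :=
  1%:M - pi_theta Pi p yix *: W0.

Definition rf_intercept (W0 : 'M[R]_n) (Pi : 'M[R]_(1 + k)) (p : params R k) :
    'cV[R]_n :=
  invmx (rf_mx W0 Pi p) *m (alpha p *: iota_vec).

Definition rf_coef (W0 : 'M[R]_n) (Pi : 'M[R]_(1 + k)) (p : params R k)
    (j : 'I_k) : 'M[R]_n :=
  invmx (rf_mx W0 Pi p) *m
    ((gamma p) j 0 *: 1%:M + pi_theta Pi p (xix j) *: W0).

Context {d : measure_display} {T : measurableType d}.
Variable P : probability T R.
Variables (X : T -> 'M[R]_(n, k)) (W0 : T -> 'M[R]_n) (Pi : 'M[R]_(1 + k)).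

Record model_assumptions (y : T -> 'cV[R]_n) (W : T -> 'M[R]_n)
    (v : T -> 'cV[R]_n) (U : T -> 'M[R]_(n, 1 + k)) (p : params R k) : Prop := {
  ma_measurable :
    [/\ measurable_mx y, measurable_mx X, measurable_mx W & measurable_mx W0]
    /\ measurable_mx v /\ measurable_mx U;
  ma_model : {ae P, forall w,
    y w = alpha p *: iota_vec + beta p *: (W w *m y w)
          + W w *m X w *m delta p + X w *m gamma p + v w};
  ma_exogenous : cond_mean_zero P <<s events X `|` events W0 >> v;
  ma_projection : {ae P, forall w,
    W w *m row_mx (y w) (X w) = W0 w *m row_mx (y w) (X w) *m Pi + U w};
  ma_projection_error :
    cond_mean_zero P
      <<s events (fun w => W0 w *m y w) `|` events W0 `|` events X >> U;
  ma_moment : forall i : 'I_n,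
    let M := fun w => let S := row_mx (y w) (X w) in
                      let w0i := (row i (W0 w))^T in
                      S^T *m w0i *m w0i^T *m S in
    integrable_mx P M /\ posdef (expectation_mx P M);
  ma_rank : \rank Pi = k.+1;
  (* The inverse is taken in \bar R, so that 1 / 0 = +oo: the bound is void when
     the largest eigenvalue is 0, as for acyclic directed networks. *)
  ma_eigenvalue : {ae P, forall w, exists2 lam : R,
    is_max_eigenvalue (W0 w) lam &
    ((pi_theta Pi p yix)%:E < (lam%:E)^-1)%E};
  (* Needed for the reduced form to exist; not implied by [ma_eigenvalue], which
     does not bound the coefficient from below. *)
  ma_invertible : {ae P, forall w, rf_mx (W0 w) Pi p \in unitmx};
  ma_nonzero : forall j : 'I_k,
    beta p * ((gamma p) j 0 * Pi yix yix + Pi (xix j) yix)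
    + \sum_(l < k) (delta p) l 0
        * ((gamma p) j 0 * Pi yix (xix l) + Pi (xix j) (xix l)) != 0;
  ma_lin_indep : lin_indep_I_A_A2 P W0 }.

(* The competing parameters share X, W0 and Pi, but may come with their own
   outcomes, network and errors. *)
Definition admissible (p : params R k) : Prop :=
  exists y W v U, model_assumptions y W v U p.

Definition same_reduced_form (p p' : params R k) : Prop :=
  {ae P, forall w, rf_intercept (W0 w) Pi p = rf_intercept (W0 w) Pi p'} /\
  forall j : 'I_k,
    {ae P, forall w, rf_coef (W0 w) Pi p j = rf_coef (W0 w) Pi p' j}.

Definition identified (p : params R k) : Prop :=
  forall p' : params R k, admissible p' -> same_reduced_form p p' -> p = p'.

End Model.

(* Main.v *)
Require Import Defs.
From mathcomp Require Import all_boot all_order all_algebra.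
From mathcomp Require Import all_classical all_reals all_analysis.
From mathcomp Require Import ring.

(** Clearing the two commuting inverses from the equality of the coefficients on
    [x_j] gives an identity between combinations of [I], [W0], [W0^2]. Comparing
    coefficients yields [gamma_j = gamma_j'] and
    [(pi_1 theta' - pi_1 theta) (pi_(j+1) theta + gamma_j pi_1 theta) = 0], whose
    second factor is the expression of assumption (3). Hence
    [Pi theta = Pi theta'], and [Pi] is invertible. *)

Set Implicit Arguments.
Unset Strict Implicit.
Unset Printing Implicit Defensive.
Import GRing.Theory.
Local Open Scope ring_scope.

(** Multiply on the left by [N *m M], which is also [M *m N]: on each side the inner factor cancels
    the inverse. *)
Lemma cross_mul_eq (R : comUnitRingType) (n m : nat) (M N : 'M[R]_n)
    (A B : 'M[R]_(n, m)) :
  M \in unitmx -> N \in unitmx -> comm_mx M N ->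
  invmx M *m A = invmx N *m B -> N *m A = M *m B.
Proof.
move=> uM uN MN /(congr1 (mulmx (N *m M))).
by rewrite -[in RHS]MN -!mulmxA !mulKVmx.
Qed.

Lemma mulmx_affine (R : comPzRingType) (n : nat) (W : 'M[R]_n) (a b c : R) :
  (1%:M - a *: W) *m (c *: 1%:M + b *: W)
  = c *: 1%:M + (b - a * c) *: W + (- (a * b)) *: (W *m W).
Proof.
rewrite mulmxBl mul1mx -scalemxAl mulmxDr -!scalemxAr mulmx1 scalerDr !scalerA.
by rewrite scalerBl scaleNr opprD !addrA.
Qed.

Lemma comm_affine_mx (R : comPzRingType) (n : nat) (W : 'M[R]_n) (a b : R) :
  comm_mx (1%:M - a *: W) (1%:M - b *: W).
Proof.
apply: comm_mxB; first exact: comm_mx1.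
apply: comm_mx_sym; apply: comm_mxB; first exact: comm_mx1.
by rewrite /comm_mx -!scalemxAl -!scalemxAr !scalerA mulrC.
Qed.

(** Here [a], [b], [c] stand for [pi_1 theta], [pi_(j+1) theta], [gamma_j], and the three equations
    compare the coefficients of [I], [W0], [W0^2]. Eliminating [b'] leaves a product equal to
    zero. *)
Lemma affine_coef_uniq (R : idomainType) (a a' b b' c c' : R) :
  c = c' -> b - a' * c = b' - a * c' -> a' * b = a * b' -> b + c * a != 0 ->
  a = a' /\ b = b'.
Proof.
move=> <- Eb Eab nz.
have Eb' : b' = b - a' * c + a * c by rewrite Eb subrK.
have : (a' - a) * (b + c * a) = 0.
  by rewrite mulrBl mulrDr Eab Eb'; ring.
move/eqP; rewrite mulf_eq0 (negPf nz) orbF subr_eq0 => /eqP Ea.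
by split=> //; rewrite Eb' Ea subrK.
Qed.

Section Identification.
Context {R : realType} {n k : nat}.

Lemma pi_thetaE (Pi : 'M[R]_(1 + k)) (p : params R k) r :
  pi_theta Pi p r
  = Pi r yix * beta p + \sum_(l < k) Pi r (xix l) * (delta p) l 0.
Proof.
rewrite /pi_theta mxE big_split_ord /= big_ord1 col_mxEu !mxE eqxx mulr1n.
by congr (_ * _ + _); apply: eq_bigr => l _; rewrite col_mxEd !mxE.
Qed.

Lemma theta_inj (p q : params R k) :
  theta p = theta q -> beta p = beta q /\ delta p = delta q.
Proof.
by move/eq_col_mx => [/matrixP/(_ 0 0)]; rewrite !mxE eqxx !mulr1n => -> ->.
Qed.

(** The values [pi_theta Pi p r] are the entries of [Pi *m theta p], and full rank makes [Pi]
    cancellable. *)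
Lemma pi_theta_inj (Pi : 'M[R]_(1 + k)) (p q : params R k) :
  \rank Pi = k.+1 -> pi_theta Pi p =1 pi_theta Pi q -> theta p = theta q.
Proof.
move=> rkPi Epq.
have uPi : Pi \in unitmx by rewrite -row_free_unit /row_free rkPi.
apply: (can_inj (mulKmx uPi)); apply/matrixP => i j; rewrite (ord1 j).
by have := Epq i; rewrite /pi_theta -!row_mul !mxE.
Qed.

(** With [c] equal to [gamma_j], this turns [ma_nonzero] into the side condition of
    [affine_coef_uniq]. *)
Lemma pi_theta_comb (Pi : 'M[R]_(1 + k)) (p : params R k) (j : 'I_k) (c : R) :
  beta p * (c * Pi yix yix + Pi (xix j) yix)
  + \sum_(l < k) (delta p) l 0 * (c * Pi yix (xix l) + Pi (xix j) (xix l))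
  = pi_theta Pi p (xix j) + c * pi_theta Pi p yix.
Proof.
rewrite !pi_thetaE [c * (_ + _)]mulrDr mulr_sumr addrACA -big_split /=.
congr (_ + _).
  by ring.
by apply: eq_bigr => l _; ring.
Qed.

Context {d : measure_display} {T : measurableType d} (P : probability T R).

(** In dimension 0 all matrices coincide, so the coefficients 1, 1, 1 would give a nontrivial
    relation. *)
Lemma lin_indep_dim_gt0 (A : T -> 'M[R]_n) :
  lin_indep_I_A_A2 P A -> (0 < n)%N.
Proof.
case: n A => // A /(_ 1 1 1)[|/eqP]; last by rewrite oner_eq0.
by apply: filterE => w; apply/matrixP => -[].
Qed.

Lemma lin_indep_coef (A : T -> 'M[R]_n) (a0 a1 a2 b0 b1 b2 : R) :
  lin_indep_I_A_A2 P A ->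
  {ae P, forall w, a0 *: 1%:M + a1 *: A w + a2 *: (A w *m A w)
                   = b0 *: 1%:M + b1 *: A w + b2 *: (A w *m A w)} ->
  [/\ a0 = b0, a1 = b1 & a2 = b2].
Proof.
move=> li ab.
have [|E0 E1 E2] := li (a0 - b0) (a1 - b1) (a2 - b2).
  apply: filterS ab => w E.
  by rewrite !scalerBl [_ - _ + (_ - _)]addrACA -opprD addrACA -opprD E subrr.
by split; apply/eqP; rewrite -subr_eq0 ?E0 ?E1 ?E2.
Qed.

Lemma rf_coef_inj (W0 : T -> 'M[R]_n) (Pi : 'M[R]_(1 + k)) (p q : params R k)
    (j : 'I_k) :
  lin_indep_I_A_A2 P W0 ->
  {ae P, forall w, rf_mx (W0 w) Pi p \in unitmx} ->
  {ae P, forall w, rf_mx (W0 w) Pi q \in unitmx} ->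
  {ae P, forall w, rf_coef (W0 w) Pi p j = rf_coef (W0 w) Pi q j} ->
  pi_theta Pi p (xix j) + (gamma p) j 0 * pi_theta Pi p yix != 0 ->
  [/\ (gamma p) j 0 = (gamma q) j 0, pi_theta Pi p yix = pi_theta Pi q yix
    & pi_theta Pi p (xix j) = pi_theta Pi q (xix j)].
Proof.
move=> li up uq Epq nz.
(* These are the coefficients that [mulmx_affine] produces after cross multiplication, so each side
   mixes [pi_1 theta] of one parameter with the numerator of the other. *)
have [] := lin_indep_coef (a0 := (gamma p) j 0) (b0 := (gamma q) j 0)
  (a1 := pi_theta Pi p (xix j) - pi_theta Pi q yix * (gamma p) j 0)
  (b1 := pi_theta Pi q (xix j) - pi_theta Pi p yix * (gamma q) j 0)
  (a2 := - (pi_theta Pi q yix * pi_theta Pi p (xix j)))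
  (b2 := - (pi_theta Pi p yix * pi_theta Pi q (xix j))) li.
  apply: filterS3 up uq Epq => w up uq Epq.
  rewrite -!mulmx_affine.
  exact: (cross_mul_eq up uq (comm_affine_mx _ _ _) Epq).
move=> Eg E1 /oppr_inj E2.
by have [] := affine_coef_uniq Eg E1 E2 nz.
Qed.

Lemma rf_intercept_inj (W0 : T -> 'M[R]_n) (Pi : 'M[R]_(1 + k))
    (p q : params R k) :
  (0 < n)%N -> pi_theta Pi p yix = pi_theta Pi q yix ->
  {ae P, forall w, rf_mx (W0 w) Pi p \in unitmx} ->
  {ae P, forall w, rf_intercept (W0 w) Pi p = rf_intercept (W0 w) Pi q} ->
  alpha p = alpha q.
Proof.
move=> n_gt0 Epq up Eint.
(* The claim does not depend on [w], and a set of full probability is nonempty, so it is enough to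
   prove it almost surely. *)
suff aeE : {ae P, forall w : T, alpha p = alpha q}.
  have PT : (0 < P setT)%E by rewrite probability_setT.
  by have [] := @filter_ex _ _ (ae_properfilter_algebraOfSetsType PT) _ aeE.
apply: filterS2 up Eint => w up.
(* By [Epq] both intercepts carry the same inverse; once it is cancelled, any entry of [iota_vec]
   gives the equality. *)
rewrite /rf_intercept {2}/rf_mx -Epq -/(rf_mx _ _ _).
move=> /(can_inj (mulKVmx up))/matrixP/(_ (Ordinal n_gt0) 0).
by rewrite !mxE !mulr1.
Qed.

End Identification.

Theorem theorem1 (R : realType) (d : measure_display) (T : measurableType d)
    (P : probability T R) (n k : nat) (hk : (0 < k)%N)
    (y : T -> 'cV[R]_n) (X : T -> 'M[R]_(n, k)) (W W0 : T -> 'M[R]_n)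
    (v : T -> 'cV[R]_n) (U : T -> 'M[R]_(n, 1 + k)) (Pi : 'M[R]_(1 + k))
    (p : params R k)
    (hp : model_assumptions P X W0 Pi y W v U p) :
  identified P X W0 Pi p.
Proof.
move=> q [y' [W' [v' [U' hq]]]] [Eint Ecoef].
have li := ma_lin_indep hp.
have up := ma_invertible hp.
have E j : [/\ (gamma p) j 0 = (gamma q) j 0,
    pi_theta Pi p yix = pi_theta Pi q yix
  & pi_theta Pi p (xix j) = pi_theta Pi q (xix j)].
  apply: (rf_coef_inj li up (ma_invertible hq) (Ecoef j)).
  by rewrite -pi_theta_comb; exact: (ma_nonzero hp).
(* The equality for [pi_1 theta] does not involve [j], but it is read off a covariate: the first one
   exists since [k] is positive. *)
have [_ Ey _] := E (Ordinal hk).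
have Eg : gamma p = gamma q.
  by apply/matrixP => i j; rewrite (ord1 j); case: (E i).
have Ea := rf_intercept_inj (lin_indep_dim_gt0 li) Ey up Eint.
have [Eb Ed] : beta p = beta q /\ delta p = delta q.
  apply/theta_inj/(pi_theta_inj (ma_rank hp)) => r.
  case: (split_ordP r) => j ->; last by case: (E j).
  by rewrite (ord1 j).
by case: p q Ea Eb Eg Ed {hp hq Eint Ecoef up E Ey}
  => [? ? ? ?] [? ? ? ?] /= -> -> -> ->.
Qed.
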